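(* Let $\mathcal{Q}=(Q,\&)$ be a prelinear quantale. Then for every $\mathcal{Q}$-ordered set $A$, every irreducible ideal of $A$ is a flat ideal of $A$.
   Context: A quantale $\mathcal{Q}=(Q,\&)$ is always assumed integral and commutative: $Q$ is a complete lattice (bottom $0$, top $1$) and $\&$ is a commutative associative operation on $Q$ with unit $1$ that distributes over arbitrary joins. Its implication $\to$ is defined by $p\&q\le r\iff q\le p\to r$. $\mathcal{Q}$ is prelinear if $(p\to q)\vee(q\to p)=1$ for all $p,q\in Q$. A $\mathcal{Q}$-ordered set is a set $A$ with a map $A(-,-):A\times A\to Q$ such that $A(x,x)=1$ and $A(y,z)\&A(x,y)\le A(x,z)$ for all $x,y,z\in A$. A fuzzy lower set of $A$ is a map $\phi:A\to Q$ with $\phi(y)\&A(x,y)\le\phi(x)$ for all $x,y$; a fuzzy upper set is a map $\psi:A\to Q$ with $A(x,y)\&\psi(x)\le\psi(y)$ for all $x,y$. Joins and meets of maps $A\to Q$ are pointwise. For fuzzy lower sets, $\mathrm{sub}_A(\phi_1,\phi_2)=\bigwedge_{x\in A}(\phi_1(x)\to\phi_2(x))$. For a fuzzy lower set $\phi$ and a fuzzy upper set $\psi$, $\phi\otimes\psi=\bigvee_{x\in A}\phi(x)\&\psi(x)$. A map $\lambda:A\to Q$ is inhabited if $\bigvee_{a\in A}\lambda(a)=1$. A fuzzy lower set $\phi$ of $A$ is an irreducible ideal if it is inhabited and $\mathrm{sub}_A(\phi,\phi_1\vee\phi_2)=\mathrm{sub}_A(\phi,\phi_1)\vee\mathrm{sub}_A(\phi,\phi_2)$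 for all fuzzy lower sets $\phi_1,\phi_2$ of $A$. It is a flat ideal if it is inhabited and $\phi\otimes(\psi_1\wedge\psi_2)=(\phi\otimes\psi_1)\wedge(\phi\otimes\psi_2)$ for all fuzzy upper sets $\psi_1,\psi_2$ of $A$. *)

(* Defs.v *)
From HB Require Import structures.
From mathcomp Require Import all_boot all_order.
From mathcomp Require Import boolp classical_sets.

Set Implicit Arguments.
Unset Strict Implicit.
Unset Printing Implicit Defensive.

Import Order.TTheory.
Local Open Scope order_scope.

(* Arbitrary joins and meets.  The defaults of [supremum] and [infimum] are
   chosen so that the empty join is [\bot] and the empty meet is [\top]. *)
Notation Join S := (supremum \bot S%classic).
Notation Meet S := (infimum \top S%classic).

HB.mixin Record isQuantale d Q of Order.TBLattice d Q := {
  supremums_neq0 : forall S : set Q, (supremums S !=set0)%classic;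
  qmul : Q -> Q -> Q;
  qmulA : associative qmul;
  qmulC : commutative qmul;
  qmul1 : right_id \top qmul;
  qmul_Join : forall (p : Q) (S : set Q),
    qmul p (Join S) = Join [set qmul p q | q in S]
}.

(* Integral commutative quantales. *)
#[short(type="quantaleType")]
HB.structure Definition Quantale d :=
  {Q of isQuantale d Q & Order.TBLattice d Q}.

Reserved Notation "p <&> q" (at level 40, left associativity).
Reserved Notation "p ~~> q" (at level 45, right associativity).
Notation "p <&> q" := (qmul p q) : order_scope.

(* The right adjoint of [qmul p]; see [le_qimp]. *)
Definition qimp d (Q : quantaleType d) (p r : Q) : Q :=
  Join [set q | p <&> q <= r].
Notation "p ~~> r" := (qimp p r) : order_scope.

Section QuantaleTheory.
Context d (Q : quantaleType d).
Implicit Types (p q r : Q) (S : set Q).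

Lemma Join_isLub S : isLub S (Join S).
Proof.
rewrite /supremum; case: ifPn => [/eqP->|_].
  by split=> [x []|b _]; exact: le0x.
by case: xgetP (supremums_neq0 S) => [x _ [ub lb] _|no [x /no]].
Qed.

Lemma Meet_isGlb S : lbound S (Meet S) /\ forall b, lbound S b -> b <= Meet S.
Proof.
rewrite /infimum; case: ifPn => [/eqP->|_].
  by split=> [x []|b _]; exact: lex1.
case: xgetP => [x _ [lb ub]|no]; first by [].
have [ub lub] := Join_isLub (lbound S).
by case: (no (Join (lbound S))); split=> // x Sx; apply: lub => b; apply.
Qed.

Lemma qmul_le2l p q r : q <= r -> p <&> q <= p <&> r.
Proof.
move=> qr; have -> : r = Join [set q; r].
  have [ub lub] := Join_isLub [set q; r]%classic.
  apply: le_anti; rewrite ub /=; last by right.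
  by apply: lub => x [->|->].
rewrite qmul_Join; apply: (Join_isLub _).1.
by exists q => //; left.
Qed.

Lemma le_qimp p q r : (q <= p ~~> r) = (p <&> q <= r).
Proof.
apply/idP/idP => [qpr|pqr]; last exact: (Join_isLub _).1.
apply: le_trans (qmul_le2l p qpr) _.
by rewrite qmul_Join; apply: (Join_isLub _).2 => _ [x + <-].
Qed.

End QuantaleTheory.

Definition prelinear d (Q : quantaleType d) : Prop :=
  forall p q : Q, (p ~~> q) `|` (q ~~> p) = \top.

Record qOrderedSet d (Q : quantaleType d) := QOrderedSet {
  qcarrier :> Type;
  qhom : qcarrier -> qcarrier -> Q;
  qhom_refl : forall x, qhom x x = \top;
  qhom_trans : forall x y z, qhom y z <&> qhom x y <= qhom x z
}.

Section Ideals.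
Context d (Q : quantaleType d) (A : qOrderedSet Q).
Implicit Types (phi psi lambda : A -> Q).

Definition fuzzy_lower phi : Prop :=
  forall x y : A, phi y <&> qhom x y <= phi x.

Definition fuzzy_upper psi : Prop :=
  forall x y : A, qhom x y <&> psi x <= psi y.

Definition fuzzy_sub phi1 phi2 : Q := Meet (range (fun x => phi1 x ~~> phi2 x)).

Definition fuzzy_tensor phi psi : Q := Join (range (fun x => phi x <&> psi x)).

Definition inhabited_map lambda : Prop := Join (range lambda) = \top.

(* On maps [A -> Q], [`|`] and [`&`] are the pointwise lattice operations
   provided by [boolp]. *)
Definition irreducible_ideal phi : Prop :=
  [/\ fuzzy_lower phi,
      inhabited_map phi &
      forall phi1 phi2, fuzzy_lower phi1 -> fuzzy_lower phi2 ->
        fuzzy_sub phi (phi1 `|` phi2) =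
        fuzzy_sub phi phi1 `|` fuzzy_sub phi phi2].

Definition flat_ideal phi : Prop :=
  [/\ fuzzy_lower phi,
      inhabited_map phi &
      forall psi1 psi2, fuzzy_upper psi1 -> fuzzy_upper psi2 ->
        fuzzy_tensor phi (psi1 `&` psi2) =
        fuzzy_tensor phi psi1 `&` fuzzy_tensor phi psi2].

End Ideals.

(* Main.v *)
Require Import Defs.
From mathcomp Require Import all_boot all_order.
From mathcomp Require Import boolp classical_sets.

(** Fix a truth value [r].  The maps [psi ~~> r], with [psi] a fuzzy upper set,
    are fuzzy lower sets, and currying turns inclusion of [phi] in such a
    map into a tensor: [sub phi (psi ~~> r) = (phi (x) psi) ~~> r].  In a
    prelinear quantale [_ ~~> r] turns binary meets into binary joins, so that
    [(psi1 `&` psi2) ~~> r] is the join of two fuzzy lower sets, to which the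
    irreducibility of [phi] applies.

    Take [r := phi (x) (psi1 `&` psi2)].  Then [phi] is included in
    [(psi1 `&` psi2) ~~> r] to degree [\top], whence
    [((phi (x) psi1) ~~> r) `|` ((phi (x) psi2) ~~> r) = \top]; multiplying
    this equality by the meet of the two tensors bounds that meet by [r].
    The lemmas that carry the proof are [qimp_meetl] and [fuzzy_sub_qimp]. *)

Set Implicit Arguments.
Unset Strict Implicit.
Unset Printing Implicit Defensive.

Import Order.TTheory.
Local Open Scope order_scope.

Section Quantale.
Context d (Q : quantaleType d).
Implicit Types p q r s : Q.

Lemma qmul_le2r p q r : p <= q -> p <&> r <= q <&> r.
Proof. by move=> pq; rewrite ![_ <&> r]qmulC; exact: qmul_le2l. Qed.

Lemma qmul_qimp_le p r : p <&> (p ~~> r) <= r.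
Proof. by rewrite -le_qimp. Qed.

Lemma qimp_top p r : p <= r -> p ~~> r = \top.
Proof. by move=> pr; apply: le_anti; rewrite lex1 le_qimp qmul1. Qed.

Lemma qimp_le2l p q r : p <= q -> q ~~> r <= p ~~> r.
Proof.
by move=> pq; rewrite le_qimp (le_trans (qmul_le2r _ pq))// qmul_qimp_le.
Qed.

(** Case analysis on a cover of the unit: since [s = s <&> \top] and
    multiplication distributes over joins, the members of the cover may be
    assumed one at a time. *)
Lemma le_qmul_cover s p q r :
  p `|` q = \top -> s <&> p <= r -> s <&> q <= r -> s <= r.
Proof.
move=> pq sp sq; rewrite -[s]qmul1 -le_qimp -pq.
by rewrite leUx !le_qimp sp.
Qed.

(** Prelinearity is the cover [(p ~~> q) `|` (q ~~> p) = \top].  On its first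
    member [p] is as good as [p `&` q], because [p <&> (p ~~> q)] lies below
    both [p] and [q]; the second member is symmetric. *)
Lemma qimp_meetl p q r : prelinear Q ->
  (p `&` q) ~~> r = (p ~~> r) `|` (q ~~> r).
Proof.
have meet_cover a b : ((a `&` b) ~~> r) <&> (a ~~> b) <= a ~~> r.
  rewrite le_qimp [((a `&` b) ~~> r) <&> _]qmulC qmulA.
  apply: le_trans (qmul_qimp_le (a `&` b) r); apply: qmul_le2r.
  rewrite lexI qmul_qimp_le andbT -[leRHS]qmul1.
  by apply: qmul_le2l; exact: lex1.
move=> linQ; apply: le_anti; apply/andP; split; last first.
  by rewrite leUx !qimp_le2l// ?leIl// leIr.
apply: le_qmul_cover (linQ p q) _ _.
  by apply: le_trans (leUl _ _); exact: meet_cover.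
by apply: le_trans (leUr _ _); rewrite meetC; exact: meet_cover.
Qed.

End Quantale.

Section Ideals.
Context d (Q : quantaleType d) (A : qOrderedSet Q).
Implicit Types (phi psi : A -> Q) (r : Q).

Lemma fuzzy_lower_qimp psi r :
  fuzzy_upper psi -> fuzzy_lower (fun x => psi x ~~> r).
Proof.
move=> psi_up x y; rewrite le_qimp [(psi y ~~> r) <&> _]qmulC qmulA [psi x <&> _]qmulC.
exact: le_trans (qmul_le2r _ (psi_up x y)) (qmul_qimp_le _ _).
Qed.

Lemma fuzzy_tensor_le phi psi r :
  fuzzy_tensor phi psi <= r <-> forall x, phi x <&> psi x <= r.
Proof.
have [ub lub] := Join_isLub (range (fun x => phi x <&> psi x)); split.
  by move=> le_r x; apply: le_trans le_r; apply: ub; exists x.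
by move=> le_r; apply: lub => _ [x _ <-].
Qed.

Lemma le_fuzzy_sub phi1 phi2 r :
  r <= fuzzy_sub phi1 phi2 <-> forall x, r <= phi1 x ~~> phi2 x.
Proof.
have [lb glb] := Meet_isGlb (range (fun x => phi1 x ~~> phi2 x)); split.
  by move=> r_le x; apply: le_trans r_le _; apply: lb; exists x.
by move=> r_le; apply: glb => _ [x _ <-].
Qed.

Lemma fuzzy_tensor_le2 phi psi1 psi2 : (forall x, psi1 x <= psi2 x) ->
  fuzzy_tensor phi psi1 <= fuzzy_tensor phi psi2.
Proof.
move=> le12; apply/fuzzy_tensor_le => x.
apply: le_trans (qmul_le2l _ (le12 x)) _.
exact: (fuzzy_tensor_le _ _ _).1.
Qed.

(** Both sides have the same lower bounds [s]: by currying, each of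
    [s <= _] says that [phi x <&> psi x <= s ~~> r] for all [x]. *)
Lemma fuzzy_sub_qimp phi psi r :
  fuzzy_sub phi (fun x => psi x ~~> r) = fuzzy_tensor phi psi ~~> r.
Proof.
have le_iff s : s <= fuzzy_sub phi (fun x => psi x ~~> r) <->
                s <= fuzzy_tensor phi psi ~~> r.
  rewrite le_fuzzy_sub le_qimp qmulC -le_qimp fuzzy_tensor_le.
  suff curry x : (s <= phi x ~~> psi x ~~> r) = (phi x <&> psi x <= s ~~> r).
    by split=> le_s x; move: (le_s x); rewrite curry.
  by rewrite !le_qimp [s <&> _]qmulC [phi x <&> psi x]qmulC qmulA.
by apply: le_anti; apply/andP; split; apply/le_iff.
Qed.

End Ideals.

Theorem proposition3p20 (d : Order.disp_t) (Q : quantaleType d)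
    (hQ : prelinear Q) (A : qOrderedSet Q) (phi : A -> Q) :
  irreducible_ideal phi -> flat_ideal phi.
Proof.
case=> phi_low phi_inh phi_irr; split=> // psi1 psi2 up1 up2.
apply: le_anti; apply/andP; split.
  by rewrite lexI !fuzzy_tensor_le2// => x; rewrite ?leIl ?leIr.
set r := fuzzy_tensor phi (psi1 `&` psi2).
have sub_top : fuzzy_sub phi
    ((fun x => psi1 x ~~> r) `|` (fun x => psi2 x ~~> r)) = \top.
  rewrite -(qimp_top (lexx r)) -fuzzy_sub_qimp; congr fuzzy_sub.
  by apply/funext => x; rewrite /= qimp_meetl.
have cover :
    (fuzzy_tensor phi psi1 ~~> r) `|` (fuzzy_tensor phi psi2 ~~> r) = \top.
  by rewrite -!fuzzy_sub_qimp -phi_irr//; exact: fuzzy_lower_qimp.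
apply: le_qmul_cover cover _ _.
  exact: le_trans (qmul_le2r _ (leIl _ _)) (qmul_qimp_le _ _).
exact: le_trans (qmul_le2r _ (leIr _ _)) (qmul_qimp_le _ _).
Qed.
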